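(* Offensive Alliance can be solved in time $\mathcal{O}^{*}(\mathrm{vc}(G)^{\mathcal{O}(\mathrm{vc}(G))})$, where $\mathrm{vc}(G)$ is the vertex cover number of the input graph $G$.
   Context: All graphs are finite, simple and undirected. For $S\subseteq V(G)$, $N(S)$ is the open neighbourhood of $S$, $S^c=V(G)\setminus S$, and $d_S(v)$ is the number of neighbours of $v$ in $S$. A non-empty set $S\subseteq V(G)$ is an offensive alliance if $d_S(v)\ge d_{S^c}(v)+1$ for every $v\in N(S)$. Offensive Alliance: given a graph $G$ and integer $r\ge 1$, is there an offensive alliance $S$ with $1\le |S|\le r$? The notation $\mathcal{O}^*$ suppresses factors polynomial in the input size. *)

(* Defs.v *)
From mathcomp Require Import all_boot.
Set Implicit Arguments.
Unset Strict Implicit.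
Unset Printing Implicit Defensive.

(* A simple graph on a finite vertex type T is a symmetric irreflexive
   e : rel T. *)
Section Graph.
Variables (T : finType) (e : rel T).

(* N(S) = N[S] \ S: members of S do not belong to N(S). *)
Definition open_nbhd (S : {set T}) : {set T} :=
  [set v | (v \notin S) && [exists u in S, e u v]].

Definition deg_in (S : {set T}) (v : T) : nat := #|[set u in S | e v u]|.

Definition offensive_alliance (S : {set T}) : Prop :=
  S != set0 /\
  forall v, v \in open_nbhd S -> deg_in S v >= deg_in (~: S) v + 1.

Definition vertex_cover (C : {set T}) : bool :=
  [forall u, forall v, e u v ==> (u \in C) || (v \in C)].

Definition vc : nat := #|[arg min_(C < [set: T] | vertex_cover C) #|C|]|.

End Graph.

(* Load/store random access machine over natural numbers, with unit cost per
   instruction. The only arithmetic is addition and truncated subtraction: the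
   bit length of the words then grows by at most one per step, so that running
   time agrees with Turing machine time up to a polynomial. *)
Inductive instr : Type :=
  | IConst of nat & nat
  | IAdd of nat & nat & nat
  | ISub of nat & nat & nat
  | ILoad of nat & nat
  | IStore of nat & nat
  | IJumpPos of nat & nat.

Definition program := seq instr.

Record state : Type :=
  State { pc : nat; reg : nat -> nat; memory : nat -> nat }.

Definition upd (f : nat -> nat) (a x : nat) : nat -> nat :=
  fun b => if b == a then x else f b.

Definition exec (c : instr) (s : state) : state :=
  let: State p rg m := s in
  match c with
  | IConst i x => State p.+1 (upd rg i x) m
  | IAdd i j k => State p.+1 (upd rg i (rg j + rg k)) m
  | ISub i j k => State p.+1 (upd rg i (rg j - rg k)) m
  | ILoad i j => State p.+1 (upd rg i (m (rg j))) m
  | IStore i j => State p.+1 rg (upd m (rg i) (rg j))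
  | IJumpPos i l => State (if 0 < rg i then l else p.+1) rg m
  end.

Definition step (P : program) (s : state) : state :=
  if onth P (pc s) is Some c then exec c s else s.

Definition halted (P : program) (s : state) : bool := size P <= pc s.

Definition init (input : seq nat) : state :=
  State 0 (fun=> 0) (nth 0 input).

Definition decides_within (P : program) (input : seq nat) (A : Prop)
    (bound : nat) : Prop :=
  exists t, [/\ t <= bound, halted P (iter t (step P) (init input)) &
    exists b : bool,
      reg (iter t (step P) (init input)) 0 = b /\ (b <-> A)].

Definition bit_length (x : nat) : nat := (trunc_log 2 x).+1.

Definition input_size (input : seq nat) : nat :=
  \sum_(x <- input) bit_length x.

Definition encode (n : nat) (e : rel 'I_n) (r : nat) : seq nat :=
  n :: r :: [seq nat_of_bool (e u v) | u <- enum 'I_n, v <- enum 'I_n].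

(* Main.v *)
Require Import Defs.
From mathcomp Require Import all_boot zify.
Set Implicit Arguments.
Unset Strict Implicit.
Unset Printing Implicit Defensive.

(* A non-empty vertex cover is an offensive alliance, so some alliance has at
   most max(1, vc) vertices, and it suffices to look for one of size at most k
   for k = 1, 2, ... until one is found or k exceeds r.

   For fixed k, grow a set S from a single vertex. If S is not an alliance, some
   v in N(S) violates the degree condition, and every alliance T containing S
   contains v or a neighbour of v outside S. If |T| <= k and v is not in T, then
   v has at most 2k - 1 neighbours, hence there are at most 2k choices for the
   next vertex. A run is thus described by its first vertex and by a number
   x < (2k)^k whose digits in base 2k are the successive choices; the algorithm
   enumerates all of these. Division by 2k is done by counting, which only
   squares the factor (2k)^k. *)

(** * A loop language compiled to the random access machine *)

Inductive cmd : Type :=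
  | Skip
  | Ins of instr
  | Seq of cmd & cmd
  | If of nat & cmd & cmd
  | Loop of nat & cmd.

Notation "a ;; b" := (Seq a b) (at level 61, right associativity).

(** [clock] counts the instructions that the compiled code executes, so that running time can be
    analysed on structured commands. *)
Record cstate : Type :=
  CState { cr : nat -> nat; cm : nat -> nat; clock : nat }.

Definition tick (s : cstate) : cstate := CState (cr s) (cm s) (clock s).+1.

Definition setr (s : cstate) (i x : nat) : cstate :=
  CState (upd (cr s) i x) (cm s) (clock s).+1.

Definition sem_ins (c : instr) (s : cstate) : cstate :=
  match c with
  | IConst i x => setr s i x
  | IAdd i j k => setr s i (cr s j + cr s k)
  | ISub i j k => setr s i (cr s j - cr s k)
  | ILoad i j => setr s i (cm s (cr s j))
  | IStore i j => CState (cr s) (upd (cm s) (cr s i) (cr s j)) (clock s).+1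
  | IJumpPos _ _ => s
  end.

Fixpoint down (A : Type) (N : nat) (f : nat -> A -> A) (x : A) : A :=
  if N is j.+1 then down j f (f j x) else x.

(** The ticks pay for the jumps of the compiled code: an else branch ends with a jump over the then
    branch, and a loop with counter zero costs two jumps. *)
Fixpoint sem (c : cmd) (s : cstate) : cstate :=
  match c with
  | Skip => s
  | Ins i => sem_ins i s
  | Seq a b => sem b (sem a s)
  | If i a b => if 0 < cr s i then sem a (tick s) else tick (sem b (tick s))
  | Loop i a =>
      if cr s i is N.+1 then
        down N.+1 (fun j s1 => tick (sem a (setr s1 i j))) (tick s)
      else tick (tick s)
  end.

Fixpoint csize (c : cmd) : nat :=
  match c with
  | Skip => 0
  | Ins _ => 1
  | Seq a b => csize a + csize b
  | If _ a b => (csize b + csize a).+2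
  | Loop _ a => (csize a).+4
  end.

(* Register 1 permanently holds 1, so that a jump on it is unconditional. *)
Fixpoint compile (c : cmd) (p : nat) : program :=
  match c with
  | Skip => [::]
  | Ins i => [:: i]
  | Seq a b => compile a p ++ compile b (p + csize a)
  | If i a b =>
      IJumpPos i (p + (csize b).+2) :: compile b p.+1 ++
      IJumpPos 1 (p + (csize b + csize a).+2)
        :: compile a (p + (csize b).+2)
  | Loop i a =>
      [:: IJumpPos i p.+2, IJumpPos 1 (p + (csize a).+4), ISub i i 1
        & compile a p.+3 ++ [:: IJumpPos i p.+2]]
  end.

Fixpoint writes (c : cmd) : seq nat :=
  match c with
  | Skip => [::]
  | Ins (IConst i _) | Ins (IAdd i _ _) | Ins (ISub i _ _)
  | Ins (ILoad i _) => [:: i]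
  | Ins _ => [::]
  | Seq a b | If _ a b => writes a ++ writes b
  | Loop i a => i :: writes a
  end.

Fixpoint storeless (c : cmd) : bool :=
  match c with
  | Skip => true
  | Ins (IStore _ _) => false
  | Ins _ => true
  | Seq a b | If _ a b => storeless a && storeless b
  | Loop _ a => storeless a
  end.

(** Raw jumps would escape the structured semantics, and a body that writes its own counter would
    break the reading of a loop as a fixed downward iteration. *)
Fixpoint wf (c : cmd) : bool :=
  match c with
  | Skip => true
  | Ins (IJumpPos _ _) => false
  | Ins _ => true
  | Seq a b | If _ a b => wf a && wf b
  | Loop i a => (i \notin writes a) && wf a
  end.

(** * Frame properties and an invariant rule for loops *)

Lemma down_ind (A : Type) (I : nat -> A -> Prop) N (f : nat -> A -> A) x :
  I N x -> (forall j y, j < N -> I j.+1 y -> I j (f j y)) -> I 0 (down N f x).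
Proof.
elim: N x => [|N IH] x //= IN step; apply: IH; first exact: step.
by move=> j y ltjN; apply: step; apply: ltnW.
Qed.

Lemma downS (A : Type) N (f : nat -> A -> A) x :
  down N.+1 f x = down N f (f N x).
Proof. by []. Qed.

Arguments down : simpl never.

Lemma updE f a x b : upd f a x b = if b == a then x else f b.
Proof. by []. Qed.

Lemma sem_frame c s x : x \notin writes c -> cr (sem c s) x = cr s x.
Proof.
elim: c s => [|i|a IHa b IHb|i a IHa b IHb|i a IHa] s //=.
- by case: i => [i ?|i ? ?|i ? ?|i ?|i ?|i ?] //=; rewrite inE updE => /negbTE->.
- by rewrite mem_cat negb_or => /andP[xa xb]; rewrite IHb ?IHa.
- rewrite mem_cat negb_or => /andP[xa xb].
  by case: ifP => _; rewrite /= ?IHa ?IHb.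
rewrite inE negb_or => /andP[xi xa]; case: (cr s i) => [|N] //.
apply: (@down_ind _ (fun _ s1 => cr s1 x = cr s x)) => // j s1 _ <-.
by rewrite /= IHa //= updE (negbTE xi).
Qed.

Lemma sem_storeless c s : storeless c -> cm (sem c s) = cm s.
Proof.
elim: c s => [|i|a IHa b IHb|i a IHa b IHb|i a IHa] s //=.
- by case: i.
- by case/andP=> sa sb; rewrite IHb ?IHa.
- by case/andP=> sa sb; case: ifP => _; rewrite /= ?IHa ?IHb.
move=> sa; case: (cr s i) => [|N] //.
apply: (@down_ind _ (fun _ s1 => cm s1 = cm s)) => // j s1 _ <-.
by rewrite /= IHa.
Qed.

(** [I j] describes the state with [j] rounds left. The bound [t] includes the decrement of the
    counter, the extra one per round is the jump back, and the 2 covers a counter that is zero at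
    the start. *)
Lemma loop_rule (I : nat -> cstate -> Prop) t i c s :
  I (cr s i) (tick s) ->
  (forall j s1, I j s1 -> I j (tick s1)) ->
  (forall j s1, j < cr s i -> I j.+1 s1 ->
     (forall x, x \notin i :: writes c -> cr s1 x = cr s x) ->
     I j (sem c (setr s1 i j)) /\
     clock (sem c (setr s1 i j)) <= clock s1 + t) ->
  I 0 (sem (Loop i c) s) /\
  clock (sem (Loop i c) s) <= clock s + 2 + cr s i * t.+1.
Proof.
move=> I0 It step /=.
case: (cr s i) I0 step => [|N] I0 step.
  by split; [exact: It | rewrite /=; lia].
pose J j s1 := [/\ I j s1, forall x, x \notin i :: writes c -> cr s1 x = cr s x
  & clock s1 + j * t.+1 <= clock s + 2 + N.+1 * t.+1].
have [|j s1 ltj [Ij fr ck]|? _ ?] :=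
  @down_ind _ J N.+1 (fun j s1 => tick (sem c (setr s1 i j))) (tick s).
- by split=> //=; lia.
- have [Ij' ck'] := step j s1 ltj Ij fr; split.
  + exact: It.
  + move=> x xn; rewrite -fr //; move: xn.
    rewrite inE negb_or => /andP[xi xc]; rewrite /= sem_frame //=.
    by rewrite updE (negbTE xi).
  + by move: ck ck'; rewrite /=; nia.
by split=> //; lia.
Qed.

(** * Correctness of compilation *)

Lemma size_compile c p : size (compile c p) = csize c.
Proof.
elim: c p => [|i|a IHa b IHb|i a IHa b IHb|i a IHa] p //=.
- by rewrite size_cat IHa IHb.
- by rewrite size_cat /= IHa IHb; lia.
- by rewrite size_cat /= IHa; lia.
Qed.

Definition at_pc (p : nat) (s : cstate) : state := State p (cr s) (cm s).

Lemma step_at P p s c : onth P p = Some c -> step P (at_pc p s) = exec c (at_pc p s).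
Proof. by rewrite /step /= => ->. Qed.

Lemma onth_drop (T : Type) (s1 s2 : seq T) j :
  onth (s1 ++ s2) (size s1 + j) = onth s2 j.
Proof. by elim: s1. Qed.

Lemma onth_mid (T : Type) (s1 s2 : seq T) x :
  onth (s1 ++ x :: s2) (size s1) = Some x.
Proof. by elim: s1 => //=. Qed.

(** Jump targets are absolute, so the code is placed between arbitrary [pre] and [post]; the
    induction absorbs the code around a subcommand into these two. The clock difference is the exact
    number of machine steps. *)
Lemma compile_correct c pre post s :
  let P := pre ++ compile c (size pre) ++ post in
  wf c -> 1 \notin writes c -> cr s 1 = 1 ->
  exists t, clock (sem c s) = clock s + t /\
    iter t (step P) (at_pc (size pre) s) = at_pc (size pre + csize c) (sem c s).
Proof.
elim: c pre post s => [|i|a IHa b IHb|i a IHa b IHb|i a IHa] pre post s /=.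
- by exists 0; rewrite !addn0.
- move=> wi ni s1; exists 1; split; first by case: i wi ni => //= *; lia.
  rewrite /= (@step_at _ _ _ i) ?onth_mid // addn1.
  by case: i wi ni.
- case/andP=> wa wb; rewrite mem_cat negb_or => /andP[na nb] s1.
  have [ta [ca ea]] := IHa pre (compile b (size pre + csize a) ++ post) s wa na s1.
  have s1' : cr (sem a s) 1 = 1 by rewrite sem_frame.
  have [tb [cb eb]] := IHb (pre ++ compile a (size pre)) post _ wb nb s1'.
  exists (tb + ta); split; first by lia.
  move: eb ea; rewrite iterD size_cat size_compile -!catA addnA => eb -> .
  by rewrite eb.
- case/andP=> wa wb; rewrite mem_cat negb_or => /andP[na nb] s1.
  set P := pre ++ _.
  have e0 : step P (at_pc (size pre) s) =
     at_pc (if 0 < cr s i then size pre + (csize b).+2 else (size pre).+1) (tick s).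
    by rewrite /P (@step_at _ _ _ _ (onth_mid _ _ _)).
  case: ifP e0 => si e0.
    (* For the then branch, the conditional jump, the else code and [J] all become part of the
       prefix. *)
    pose J := IJumpPos 1 (size pre + (csize b + csize a).+2).
    have [ta [ca ea]] := IHa (pre ++ IJumpPos i (size pre + (csize b).+2) ::
      compile b (size pre).+1 ++ [:: J]) post (tick s) wa na s1.
    exists ta.+1; split; first by rewrite ca /=; lia.
    move: ea; rewrite size_cat /= size_cat size_compile /= addn1.
    rewrite addnS -catA /= -catA /= => ea.
    rewrite -iterS iterSr e0 /P -!catA /= (addnS _ (csize b).+1) ea.
    by congr at_pc; lia.
  pose J := IJumpPos 1 (size pre + (csize b + csize a).+2).
  pose Ca := compile a (size pre + (csize b).+2).
  have := IHb (pre ++ [:: IJumpPos i (size pre + (csize b).+2)]) (J :: Ca ++ post)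
    (tick s) wb nb s1.
  rewrite size_cat /= addn1 -!catA /= => -[tb [cb eb]].
  have eP : P = pre ++ (IJumpPos i (size pre + (csize b).+2)
      :: compile b (size pre).+1) ++ J :: Ca ++ post.
    by rewrite /P -!catA.
  exists tb.+2; split; first by rewrite cb /=; lia.
  rewrite iterS iterSr e0 eP /= eb.
  rewrite (@step_at _ _ _ J); last first.
    have -> : (size pre).+1 + csize b = size (pre ++ IJumpPos i (size pre + (csize b).+2)
      :: compile b (size pre).+1) by rewrite size_cat /= size_compile; lia.
    by rewrite -cat_cons catA onth_mid.
  by rewrite /J /= sem_frame //= s1 /=; congr State; lia.
case/andP=> ni wa; rewrite inE negb_or => /andP[i1 na] s1.
set P := pre ++ _.
have i1' : (i == 1) = false by rewrite eq_sym (negbTE i1).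
have e0 s' : step P (at_pc (size pre) s') =
     at_pc (if 0 < cr s' i then (size pre).+2 else (size pre).+1) (tick s').
  by rewrite /P (@step_at _ _ _ _ (onth_mid _ _ _)).
case EN: (cr s i) => [|N].
  exists 2; split; first by rewrite /=; lia.
  rewrite /= e0 EN /= (@step_at _ _ _ (IJumpPos 1 (size pre + (csize a).+4))).
    by rewrite /= s1.
  by rewrite -addn1 onth_drop.
have e2 s' M : cr s' i = M.+1 -> cr s' 1 = 1 ->
    step P (at_pc (size pre).+2 s') = at_pc (size pre).+3 (setr s' i M).
  move=> EM E1; rewrite (@step_at _ _ _ (ISub i i 1)).
    by rewrite /= E1 EM subn1.
  by rewrite -addn2 onth_drop.
have e3 s' : step P (at_pc ((size pre).+3 + csize a) s') =
    at_pc (if 0 < cr s' i then (size pre).+2 else size pre + (csize a).+4) (tick s').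
  rewrite (@step_at _ _ _ (IJumpPos i (size pre).+2)).
    by rewrite /=; case: ifP => _ //; congr State; lia.
  rewrite -addn3 -addnA onth_drop /= -catA -(size_compile a (size pre).+3).
  exact: onth_mid.
have eb s' : cr s' 1 = 1 -> exists t, clock (sem a s') = clock s' + t /\
    iter t (step P) (at_pc (size pre).+3 s') = at_pc ((size pre).+3 + csize a) (sem a s').
  move=> E1.
  have := IHa (pre ++ [:: IJumpPos i (size pre).+2;
      IJumpPos 1 (size pre + (csize a).+4); ISub i i 1])
      (IJumpPos i (size pre).+2 :: post) s' wa na E1.
  rewrite size_cat /= addn3 -catA /= => -[t [ct et]]; exists t; split=> //.
  by rewrite /P -catA.
(* The entry jump runs only once, so the induction on the counter starts at the decrement, where the
   jump back lands. *)
have loop M s' : cr s' i = M.+1 -> cr s' 1 = 1 ->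
  let s2 := down M.+1 (fun j s1 => tick (sem a (setr s1 i j))) s' in
  exists t, clock s2 = clock s' + t /\
    iter t (step P) (at_pc (size pre).+2 s') = at_pc (size pre + (csize a).+4) s2.
  elim: M s' => [|M IH] s' EM E1; rewrite downS.
    have := eb (setr s' i 0); rewrite /= updE (negbTE i1) E1 => /(_ erefl)[t [ct et]].
    exists t.+2; split; first by rewrite ct; lia.
    rewrite iterS iterSr (e2 _ _ EM E1) et e3 sem_frame //=.
    by rewrite updE eqxx.
  have := eb (setr s' i M.+1); rewrite /= updE (negbTE i1) E1 => /(_ erefl)[t [ct et]].
  set s3 := sem a _ in ct et *.
  have s3i : cr s3 i = M.+1 by rewrite sem_frame //= updE eqxx.
  have [||t' [ct' et']] := IH (tick s3).
  - by [].
  - by rewrite /= sem_frame //= updE (negbTE i1).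
  exists (t' + t.+2); split; first by rewrite ct' /= ct; lia.
  by rewrite iterD iterS iterSr (e2 _ _ EM E1) et e3 s3i.
have [||t [ct et]] := loop N (tick s); rewrite ?EN //.
exists t.+1; split; first by rewrite ct /=; lia.
by rewrite iterSr e0 EN et.
Qed.

(** * The program *)

(* Registers: 0 answer; 1 the constant one; 2 n; 3 number of rounds left;
   4 address of the indicator array of S, which follows the input; 5 k; 6 the
   base 2k; 7 x; 8 first vertex; 9 steps left in a run; 10 undecoded digits of x;
   11 current digit; 12 one plus the violating vertex, or 0; 13 v; 14 address of
   row v of the adjacency matrix; 15 u; 16, 17 degrees of v into S and its
   complement (16 is also the chosen vertex); 18, 19 scratch; 20 (2k)^k. *)
Definition copy (i j : nat) : cmd := Ins (IConst i 0) ;; Ins (IAdd i i j).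

Definition row_cmd : cmd :=
  Ins (IConst 14 2) ;; copy 18 13 ;; Loop 18 (Ins (IAdd 14 14 2)).

Definition count_cmd : cmd :=
  Ins (IConst 16 0) ;; Ins (IConst 17 0) ;; copy 15 2 ;;
  Loop 15 (Ins (IAdd 18 14 15) ;; Ins (ILoad 18 18) ;;
    If 18 (Ins (IAdd 18 4 15) ;; Ins (ILoad 18 18) ;;
      If 18 (Ins (IAdd 16 16 1)) (Ins (IAdd 17 17 1))) Skip).

Definition test_cmd : cmd :=
  Ins (IAdd 18 4 13) ;; Ins (ILoad 18 18) ;;
  If 18 Skip (If 16 (Ins (IAdd 17 17 1) ;; Ins (ISub 17 17 16) ;;
    If 17 (Ins (IAdd 12 13 1)) Skip) Skip).

Definition check_cmd : cmd :=
  Ins (IConst 12 0) ;; copy 13 2 ;;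
  Loop 13 (row_cmd ;; count_cmd ;; test_cmd).

Definition div_cmd : cmd :=
  Ins (IConst 19 0) ;; Ins (IConst 11 0) ;;
  Loop 10 (Ins (IAdd 11 11 1) ;; Ins (ISub 18 6 11) ;;
    If 18 Skip (Ins (IConst 11 0) ;; Ins (IAdd 19 19 1))) ;;
  copy 10 19.

Definition pick_cmd : cmd :=
  Ins (ISub 13 12 1) ;; row_cmd ;; copy 16 13 ;; copy 15 2 ;;
  Loop 15 (Ins (IAdd 18 14 15) ;; Ins (ILoad 18 18) ;;
    If 18 (If 11 (Ins (ISub 11 11 1) ;; If 11 Skip (copy 16 15)) Skip) Skip) ;;
  Ins (IAdd 18 4 16) ;; Ins (IStore 18 1).

Definition clear_cmd : cmd :=
  copy 15 2 ;; Ins (IConst 19 0) ;;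
  Loop 15 (Ins (IAdd 18 4 15) ;; Ins (IStore 18 19)).

Definition branch_cmd : cmd :=
  check_cmd ;; If 12 (div_cmd ;; pick_cmd) (Ins (IConst 0 1)).

Definition attempt_cmd : cmd :=
  clear_cmd ;; Ins (IAdd 18 4 8) ;; Ins (IStore 18 1) ;;
  copy 10 7 ;; copy 9 5 ;; Loop 9 branch_cmd.

Definition power_cmd : cmd :=
  Ins (IConst 7 1) ;; copy 9 5 ;;
  Loop 9 (Ins (IConst 19 0) ;; copy 18 6 ;; Loop 18 (Ins (IAdd 19 19 7)) ;;
    copy 7 19) ;;
  copy 20 7.

Definition try_cmd : cmd :=
  power_cmd ;; copy 8 2 ;; Loop 8 (copy 7 20 ;; Loop 7 attempt_cmd).

(** The number of rounds is [minn n r], obtained as [n - (n - r)] by truncated subtraction. Capping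
    by [n] makes the running time independent of the value of [r]. *)
Definition setup_cmd : cmd :=
  Ins (IConst 2 0) ;; Ins (ILoad 2 2) ;; Ins (ILoad 3 1) ;;
  Ins (IConst 4 2) ;; copy 15 2 ;; Loop 15 (Ins (IAdd 4 4 2)) ;;
  Ins (ISub 18 2 3) ;; Ins (ISub 3 2 18) ;;
  Ins (IConst 5 0) ;; Ins (IConst 0 0).

(** Loops have no early exit: once the answer is set, each remaining round costs only a constant. *)
Definition main_cmd : cmd :=
  setup_cmd ;;
  Loop 3 (Ins (IAdd 5 5 1) ;; Ins (IAdd 6 5 5) ;; If 0 Skip try_cmd).

(** * The search as a function of the memory contents *)

(** Memory layout: cells 0 and 1 hold [n] and [r], the next [n * n] cells hold the adjacency matrix
    row by row, and the indicator array of the current set follows. *)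
Definition adj n (m : nat -> nat) v u : bool := 0 < m (2 + v * n + u).
Definition sel n (m : nat -> nat) u : bool := 0 < m (2 + n * n + u).

Definition indeg n m v := \sum_(0 <= u < n) (adj n m v u && sel n m u).
Definition outdeg n m v := \sum_(0 <= u < n) (adj n m v u && ~~ sel n m u).

Definition bad n m v : bool :=
  [&& ~~ sel n m v, 0 < indeg n m v & indeg n m v <= outdeg n m v].

(** The scan runs downwards and later writes win, so this is one plus the least bad vertex, or 0 if
    there is none. *)
Definition violator n m : nat :=
  down n (fun v a => if bad n m v then v.+1 else a) 0.

Definition scan_neighbour n m v u (p : nat * nat) : nat * nat :=
  if adj n m v u && (0 < p.1) then (p.1.-1, if 0 < p.1.-1 then p.2 else u)
  else p.

(** Digit 0 selects [v] itself and a positive [d] the [d]-th neighbour of [v] in decreasing order; a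
    digit above the degree falls back to [v]. *)
Definition chosen n m v d : nat := (down n (scan_neighbour n m v) (d, v)).2.

(* Whether the run with remaining digits q reaches an alliance within k steps. *)
Fixpoint success n B k m q : bool :=
  if k is k'.+1 then
    if violator n m is v.+1 then
      success n B k' (upd m (2 + n * n + chosen n m v (q %% B)) 1) (q %/ B)
    else true
  else false.

(** * Correctness and running time of the program *)

Definition env n s := [/\ cr s 1 = 1, cr s 2 = n & cr s 4 = 2 + n * n].

Lemma env_frame c n s :
  ~~ has (mem [:: 1; 2; 4]) (writes c) -> env n s -> env n (sem c s).
Proof.
move=> /hasPn nw [e1 e2 e4].
have fr x : x \in [:: 1; 2; 4] -> cr (sem c s) x = cr s x.
  by move=> xin; apply: sem_frame; apply/negP => /nw; rewrite /= xin.
by split; rewrite fr.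
Qed.

Lemma sem_seq a b s : sem (a ;; b) s = sem b (sem a s).
Proof. by []. Qed.

Lemma sem_if i a b s : sem (If i a b) s =
  if 0 < cr s i then sem a (tick s) else tick (sem b (tick s)).
Proof. by []. Qed.

Lemma row_spec s :
  cr (sem row_cmd s) 14 = 2 + cr s 13 * cr s 2 /\
  clock (sem row_cmd s) <= clock s + 5 + cr s 13 * 3.
Proof.
rewrite /row_cmd !sem_seq; set s1 := (X in sem (Loop _ _) X).
have e18 : cr s1 18 = cr s 13 by [].
pose I j s' := cr s' 14 = 2 + (cr s 13 - j) * cr s 2.
have [|//|j s2 ltj Ij fr|-> ck] :=
  @loop_rule I 2 18 (Ins (IAdd 14 14 2)) s1.
- by rewrite /I e18 subnn.
- split; last by rewrite /=; lia.
  rewrite e18 in ltj; rewrite /I /= /upd /= (fr 2) // Ij (_ : cr s1 2 = cr s 2) //.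
  by rewrite -addnA -mulSnr -subSn.
by rewrite subn0; split=> //; move: ck; rewrite e18 /=; lia.
Qed.

Lemma count_spec n v s : env n s -> cr s 14 = 2 + v * n ->
  let s' := sem count_cmd s in
  [/\ cr s' 16 = indeg n (cm s) v, cr s' 17 = outdeg n (cm s) v
    & clock s' <= clock s + 6 + n * 11].
Proof.
case=> e1 e2 e4 e14 s'; rewrite /s' /count_cmd !sem_seq.
set c := (X in sem (Loop _ X) _); set s1 := (X in sem (Loop _ _) X).
pose I j s' := [/\ cm s' = cm s,
  cr s' 16 = \sum_(j <= u < n) (adj n (cm s) v u && sel n (cm s) u) &
  cr s' 17 = \sum_(j <= u < n) (adj n (cm s) v u && ~~ sel n (cm s) u)].
have e15 : cr s1 15 = n by rewrite /s1 /= /upd /= e2.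
have [|//|j s2|[_ -> ->] ck] :=
  @loop_rule I 10 15 c s1.
- by rewrite e15 /I !big_geq //; split.
- rewrite e15 => ltj [Im I16 I17] fr.
  rewrite /I !(big_ltn ltj) -I16 -I17 /c /= /upd /= (fr 14) // (fr 4) // Im.
  rewrite (_ : cr s1 14 = 2 + v * n) // (_ : cr s1 4 = 2 + n * n) // /adj /sel.
  rewrite (fr 1) // (_ : cr s1 1 = 1) //.
  case: ifP => _ /=; last by split=> //; lia.
  by case: ifP => _ /=; (split; last by lia); split=> //; rewrite /upd /=; lia.
by split=> //; move: ck; rewrite e15 /=; lia.
Qed.

Lemma check_spec n s : env n s ->
  let s' := sem check_cmd s in
  cr s' 12 = violator n (cm s) /\ clock s' <= clock s + 5 + n * (n * 14 + 23).
Proof.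
move=> env_s s'; rewrite /s' /check_cmd !sem_seq -/row_cmd.
set c := (X in sem (Loop _ X) _); set s1 := (X in sem (Loop _ _) X).
have env1 : env n s1 by exact: env_s.
have e13 : cr s1 13 = n by case: env_s.
pose f v a := if bad n (cm s) v then v.+1 else a.
(* The invariant says that completing the remaining rounds from the current register yields the
   final value, so partial results never have to be described. *)
pose I j s' := cm s' = cm s /\ down j f (cr s' 12) = down n f 0.
have [|//|j s2|[_ I0] ck] := @loop_rule I (n * 14 + 22) 13 c s1.
- by rewrite e13.
- rewrite e13 => ltj [Im I12] fr.
  have env2 : env n (setr s2 13 j).
    by case: env1 => *; split; rewrite /= /upd /= fr.
  rewrite /c sem_seq; have [r14 rck] := row_spec (setr s2 13 j).
  have Im2 : cm (sem row_cmd (setr s2 13 j)) = cm s by rewrite sem_storeless.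
  have fr2 x : x \notin writes row_cmd ->
      cr (sem row_cmd (setr s2 13 j)) x = cr (setr s2 13 j) x.
    exact: sem_frame.
  move: r14 rck Im2 (env_frame (c := row_cmd) isT env2) fr2.
  set s3 := sem row_cmd _ => r14 rck Im2 env3 fr3.
  have {}r14 : cr s3 14 = 2 + j * n by rewrite r14; case: env2 => _ -> _.
  rewrite sem_seq; have [] := count_spec env3 r14.
  have : cm (sem count_cmd s3) = cm s by rewrite sem_storeless.
  have fr4 x : x \notin writes count_cmd -> cr (sem count_cmd s3) x = cr s3 x.
    exact: sem_frame.
  move: fr4 (env_frame (c := count_cmd) isT env3).
  set s4 := sem count_cmd s3 => fr4 [e1 _ e4] m4 c16 c17 ck4.
  rewrite Im2 in c16 c17.
  have e13' : cr s4 13 = j by rewrite fr4 // fr3.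
  have e12 : cr s4 12 = cr s2 12 by rewrite fr4 // fr3.
  move: rck; rewrite /= => rck.
  have lt4 : clock s4 <= clock s2 + 12 + j * 3 + n * 11.
    by move: ck4 rck; rewrite /= /upd /=; lia.
  move: I12; rewrite /I downS /= /upd /= e4 m4 e13' c16 c17 -e12 /f /bad /sel => <-.
  case: ifP => _ /=; first by split=> //; lia.
  case: ifP => _ /=; rewrite ?c16 ?c17 ?e1 /=; last by split=> //; lia.
  rewrite /upd /= addn1 subn_gt0 ltnS /=.
  by case: ifP => _ /=; rewrite /= ?e1 ?e13' ?addn1; split=> //; lia.
have ck1 : clock s1 = clock s + 3 by rewrite addn3.
move: I0 ck; rewrite e13 ck1; move: (sem (Loop 13 c) s1) => s5 I0 ck.
by split; [exact: I0 | lia].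
Qed.

Lemma div_spec B s : cr s 1 = 1 -> cr s 6 = B -> 0 < B ->
  let s' := sem div_cmd s in
  [/\ cr s' 11 = cr s 10 %% B, cr s' 10 = cr s 10 %/ B
    & clock s' <= clock s + 6 + cr s 10 * 8].
Proof.
move=> e1 e6 B0 s'; rewrite /s' /div_cmd !sem_seq.
set c := (X in sem (Loop _ X) _); set s1 := (X in sem (Loop _ _) X).
have e10 : cr s1 10 = cr s 10 by [].
(* The units counted so far form full blocks of size [B] and a partial block; [j] units are still
   uncounted. *)
pose I j s' := cr s 10 = cr s' 19 * B + cr s' 11 + j /\ cr s' 11 < B.
have [|//|j s2|[E lt11] ck] := @loop_rule I 7 10 c s1.
- by rewrite e10 /I.
- rewrite e10 => ltj [Ij lt2] fr.
  rewrite /I /c /= /upd /= (fr 1) // (fr 6) // (_ : cr s1 1 = 1) //.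
  rewrite (_ : cr s1 6 = B) // subn_gt0.
  case: ifP => lt11; rewrite /= /upd /=; first by split; [split; lia | lia].
  rewrite ?(fr 1) // ?(_ : cr s1 1 = 1) // mulnDl.
  by split; [split; lia | lia].
set s3 := sem (Loop _ _) _ in E lt11 ck *.
rewrite E addn0 /= /upd /= add0n divnMDl // modnMDl !modn_small ?divn_small //.
by rewrite addn0; split=> //; move: ck; rewrite e10 /=; lia.
Qed.

Lemma pick_spec n v s : env n s -> cr s 12 = v.+1 -> v < n ->
  let s' := sem pick_cmd s in
  cm s' = upd (cm s) (2 + n * n + chosen n (cm s) v (cr s 11)) 1 /\
  clock s' <= clock s + 14 + n * 15.
Proof.
move=> env_s e12 ltvn s'; rewrite /s' /pick_cmd !(sem_seq (Ins _)) sem_seq.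
set s0 := sem (Ins _) s.
have e13 : cr s0 13 = v by case: env_s => e1 _ _; rewrite /= /upd /= e12 e1; lia.
have env0 : env n s0 by exact: env_s.
have [r14 rck] := row_spec s0.
have : cm (sem row_cmd s0) = cm s by rewrite sem_storeless.
have fr1 x : x \notin writes row_cmd -> cr (sem row_cmd s0) x = cr s0 x.
  exact: sem_frame.
move: r14 rck (env_frame (c := row_cmd) isT env0) fr1.
set s1 := sem row_cmd s0 => r14 rck env1 fr1 m1.
have {}r14 : cr s1 14 = 2 + v * n by rewrite r14 e13; case: env0 => _ -> _.
have e11 : cr s1 11 = cr s 11 by rewrite fr1.
have {}e13 : cr s1 13 = v by rewrite fr1.
rewrite !sem_seq.
set c := (X in sem (Loop _ X) _); set s2 := (X in sem (Loop _ _) X).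
have env2 : env n s2 by exact: env1.
have e15 : cr s2 15 = n by case: env1.
pose I j s' := cm s' = cm s /\
  down j (scan_neighbour n (cm s) v) (cr s' 11, cr s' 16) =
  down n (scan_neighbour n (cm s) v) (cr s 11, v).
have [|//|j s3|[I0m I0] ck] := @loop_rule I 11 15 c s2.
- by rewrite /I e15 /= m1 /upd /= e11 e13.
- rewrite e15 => ltj [Im Ij] fr.
  case: env2 => E1 _ _.
  rewrite /I -Ij downS /c /= /upd /= (fr 14) // (_ : cr s2 14 = 2 + v * n) //.
  rewrite Im (fr 1) // E1 /scan_neighbour /= /adj subn1.
  case: ifP => _ /=; last by split=> //; lia.
  case: ifP => lt0 /=; last by split=> //; lia.
  rewrite /upd /= ?(fr 1) // ?E1 ?subn1.
  by case: ifP => _ /=; split=> //; lia.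
have [] := env_frame (c := Loop 15 c) isT env2.
move: I0m I0 ck; set s3 := sem (Loop _ _) _ => I0m I0 ck E1 _ E4.
have {}I0 : cr s3 16 = chosen n (cm s) v (cr s 11) by rewrite /chosen -I0.
split; first by rewrite /= /upd /= I0m E1 E4 I0.
by move: ck rck; rewrite e15 /= /upd /= e12; case: env_s => -> _ _; lia.
Qed.

Lemma violator_cases n m : {v | violator n m = v.+1 & (v < n) && bad n m v} +
  {violator n m = 0 /\ forall v, v < n -> ~~ bad n m v}.
Proof.
pose I j a := (if a is v.+1 then (v < n) && bad n m v else true) /\
  (a = 0 -> forall v, j <= v < n -> ~~ bad n m v).
have [] : I 0 (violator n m).
  apply: down_ind; first by split=> // _ v /andP[? ?]; lia.
  move=> j a ltj [Ia Ib]; case: ifP => bj; first by split=> //=; rewrite ltj.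
  split=> // a0 v /andP[]; rewrite leq_eqVlt => /orP[/eqP<- _|lv ltv].
    by rewrite bj.
  by apply: Ib => //; rewrite lv.
case: (violator n m) => [_ H|v H _]; first by right; split=> // v lv; apply: H.
by left; exists v.
Qed.

(** The disjunction of the answer flag with the outcome of the remaining search is preserved, with
    one step fewer left; this is what [attempt_spec] iterates. Register 10 never grows, so its
    initial value bounds the cost of every division in a run. *)
Lemma branch_spec n B s : env n s -> cr s 6 = B -> 0 < B ->
  let s' := sem branch_cmd s in
  let m := cm s in
  [/\ forall k, (0 < cr s' 0) || success n B k (cm s') (cr s' 10) =
        (0 < cr s 0) || success n B k.+1 m (cr s 10),
      cr s 0 <= 1 -> cr s' 0 <= 1,
      cr s' 10 <= cr s 10,
      forall a, a < 2 + n * n -> cm s' a = m a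
    & clock s' <= clock s + 29 + n * (n * 14 + 39) + cr s 10 * 8].
Proof.
move=> env_s e6 B0 s' m; rewrite /s' /m {s' m}.
rewrite /branch_cmd sem_seq; have [r12 ck] := check_spec env_s.
have : cm (sem check_cmd s) = cm s by rewrite sem_storeless.
have fr1 x : x \notin writes check_cmd -> cr (sem check_cmd s) x = cr s x.
  exact: sem_frame.
move: r12 ck (env_frame (c := check_cmd) isT env_s) fr1.
move: (sem check_cmd s) => s1 r12 ck env1 fr1 m1.
rewrite -m1 in r12 *.
have e10 : cr s1 10 = cr s 10 by rewrite fr1.
case: (violator_cases n (cm s1)) => [[v cv /andP[ltv _]]|[c0 _]]; last first.
  rewrite sem_if r12 c0 /= /upd /= c0 e10; split=> //; last by lia.
  by move=> k; rewrite orbT.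
rewrite sem_if r12 cv sem_seq [0 < _.+1]/=.
have [d11 d10 dck] := div_spec (s := tick s1)
  (let: And3 e1 _ _ := env1 in e1) (etrans (fr1 6 isT) e6) B0.
have : cm (sem div_cmd (tick s1)) = cm s1 by rewrite sem_storeless.
have fr2 x : x \notin writes div_cmd -> cr (sem div_cmd (tick s1)) x = cr s1 x.
  exact: sem_frame.
move: d11 d10 dck (env_frame (c := div_cmd) (s := tick s1) isT env1) fr2.
move: (sem div_cmd (tick s1)) => s2 d11 d10 dck env2 fr2 m2.
have e12 : cr s2 12 = v.+1 by rewrite fr2 // r12.
have [m3 ck3] := pick_spec env2 e12 ltv.
have fr3 x : x \notin writes pick_cmd -> cr (sem pick_cmd s2) x = cr s2 x.
  exact: sem_frame.
move: m3 ck3 fr3; move: (sem pick_cmd s2) => s3 m3 ck3 fr3.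
have e0 : cr s3 0 = cr s 0 by rewrite fr3 // fr2 // fr1.
have e10' : cr s3 10 = cr s 10 %/ B by rewrite fr3 // d10 -e10.
split.
- by move=> k; rewrite e0 m3 e10' d11 /= cv e10 m2.
- by rewrite e0.
- by rewrite e10' leq_div.
- move=> a lta; rewrite m3 /upd m2; case: eqP => // Ea; lia.
by move: ck ck3 dck; rewrite e10 /=; lia.
Qed.

Lemma eq_down (A : Type) N (f g : nat -> A -> A) x :
  (forall j y, j < N -> f j y = g j y) -> down N f x = down N g x.
Proof.
elim: N x => [|N IH] x //= fg; rewrite !downS fg // IH // => j y ltj.
by apply: fg; apply: ltnW.
Qed.

(** The search reads and writes only the matrix and the indicator array, so leftover contents beyond
    them cannot influence a run. *)
Lemma success_ext n B k m m' q :
  (forall a, a < 2 + n * n + n -> m a = m' a) ->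
  success n B k m q = success n B k m' q.
Proof.
elim: k m m' q => [|k IH] m m' q //= mm'.
have adjE v u : v < n -> u < n -> adj n m v u = adj n m' v u.
  by move=> ltv ltu; rewrite /adj mm' //; nia.
have selE u : u < n -> sel n m u = sel n m' u.
  by move=> ltu; rewrite /sel mm' //; lia.
have chkE : violator n m = violator n m'.
  apply: eq_down => v y ltv; rewrite /bad selE //.
  suff [-> ->] : indeg n m v = indeg n m' v /\ outdeg n m v = outdeg n m' v by [].
  by split; apply: eq_big_nat => u /andP[_ ltu]; rewrite adjE ?selE.
rewrite -chkE; case: (violator_cases n m) => [[v -> /andP[ltv _]]|[-> _]] //.
have -> : chosen n m v (q %% B) = chosen n m' v (q %% B).
  rewrite /chosen (eq_down (g := scan_neighbour n m' v)) // => u p ltu.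
  by rewrite /scan_neighbour adjE.
by apply: IH => a lta; rewrite !updE mm'.
Qed.

Lemma clear_spec n s : env n s ->
  let s' := sem clear_cmd s in
  [/\ forall a, a < 2 + n * n -> cm s' a = cm s a,
      forall u, u < n -> cm s' (2 + n * n + u) = 0
    & clock s' <= clock s + 5 + n * 4].
Proof.
case=> e1 e2 e4 s'; rewrite /s' /clear_cmd !sem_seq.
set c := (X in sem (Loop _ X) _); set s1 := (X in sem (Loop _ _) X).
have e15 : cr s1 15 = n by [].
pose I j s' := (forall a, a < 2 + n * n -> cm s' a = cm s a) /\
  (forall u, j <= u < n -> cm s' (2 + n * n + u) = 0).
have [|//|j s2|[I1 I2] ck] := @loop_rule I 3 15 c s1.
- by rewrite e15; split=> // u; lia.
- rewrite e15 => ltj [Ia Ib] fr.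
  rewrite /I /c /= /upd /= (fr 4) // (fr 19) // (_ : cr s1 4 = 2 + n * n) //.
  rewrite (_ : cr s1 19 = 0) //; split; last by lia.
  split=> [a lta|u ltu]; first by case: eqP => [?|_]; [lia | exact: Ia].
  by case: eqP => // neq; apply: Ib; lia.
by split=> //; move: ck; rewrite e15 /=; lia.
Qed.

(** Idealised memory at the beginning of a run: the input, then the indicator of the single vertex
    [v], and zero elsewhere. *)
Definition start n (M : nat -> nat) v a : nat :=
  if a < 2 + n * n then M a else a == 2 + n * n + v.

Definition attempt_time n k x : nat :=
  13 + n * 4 + k * (31 + n * (n * 14 + 39) + x * 8).

Lemma attempt_spec n k B M s : env n s -> cr s 5 = k -> cr s 6 = B -> 0 < B ->
  cr s 0 <= 1 -> cr s 8 < n -> (forall a, a < 2 + n * n -> cm s a = M a) ->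
  let s' := sem attempt_cmd s in
  [/\ (0 < cr s' 0) =
        (0 < cr s 0) || success n B k (start n M (cr s 8)) (cr s 7),
      cr s' 0 <= 1, forall a, a < 2 + n * n -> cm s' a = M a
    & clock s' <= clock s + attempt_time n k (cr s 7)].
Proof.
move=> env_s e5 e6 B0 le0 lt8 sM s'; rewrite /s' {s'} /attempt_cmd sem_seq.
have [m1 m2 ck] := clear_spec env_s.
have fr x : x \notin writes clear_cmd -> cr (sem clear_cmd s) x = cr s x.
  exact: sem_frame.
move: m1 m2 ck fr (env_frame (c := clear_cmd) isT env_s).
move: (sem clear_cmd s) => s1 m1 m2 ck fr1 env1.
rewrite -!(fr1 0, fr1 5, fr1 6, fr1 7, fr1 8) // in e5 e6 le0 lt8 *.
rewrite !sem_seq -/check_cmd.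
set s2 := (X in sem (Loop _ _) X).
have {}e5 : cr s2 9 = k by [].
have {}e6 : cr s2 6 = B by [].
have e0 : cr s2 0 = cr s1 0 by [].
have e10 : cr s2 10 = cr s1 7 by [].
have env2 : env n s2 by exact: env1.
have ms2 a : a < 2 + n * n + n -> cm s2 a = start n M (cr s1 8) a.
  case: (env1) => E1 E2 E4 lta.
  rewrite /s2 /= /upd /= E4 E1 /start.
  case: ltnP => cmp; first by case: eqP => [?|_]; [lia | rewrite m1 ?sM].
  by case: eqP => //= neq; rewrite -(subnKC cmp) m2 //; lia.
have ck2 : clock s2 = clock s1 + 6 by rewrite /=; lia.
have low2 a : a < 2 + n * n -> cm s2 a = M a.
  by move=> lta; rewrite ms2 ?/start ?lta //; lia.
move: (cr s1 0) (cr s1 7) (cr s1 8) => f x v in le0 lt8 e0 e10 ms2 *.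
move: s2 e5 e6 e0 e10 env2 ms2 ck2 low2 => s2 e9 e6' e0 e10 env2 ms2 ck2 low2.
pose I j s' := [/\ (0 < cr s' 0) || success n B j (cm s') (cr s' 10) =
    (0 < f) || success n B k (start n M v) x, cr s' 0 <= 1,
    cr s' 10 <= x & forall a, a < 2 + n * n -> cm s' a = M a].
have [|//|j s3|[I0 I1 I2 I3] ck3] :=
  @loop_rule I (30 + n * (n * 14 + 39) + x * 8) 9 branch_cmd s2.
- rewrite e9; split; rewrite ?[cr (tick _) _]/= ?e0 ?e10 //.
  by rewrite (success_ext _ _ _ ms2).
- rewrite e9 => ltj [Ia Ib Ic Id] fr.
  have env3 : env n (setr s3 9 j).
    by case: env2 => *; split; rewrite /= /upd /= fr.
  have e6 : cr (setr s3 9 j) 6 = B by rewrite /= /upd /= fr.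
  have [Ja Jb Jc Jd Je] := branch_spec env3 e6 B0.
  move: Ja Jb Jc Jd Je; move: (sem branch_cmd _) => s4 Ja Jb Jc Jd Je.
  move: Jc Je; rewrite /= /upd /= => Jc Je.
  split; last by lia.
  split.
  + by rewrite Ja.
  + exact: Jb.
  + exact: leq_trans Jc _.
  + by move=> a lta; rewrite Jd //=; apply: Id.
rewrite e9 ck2 in ck3.
move: I0 I1 I3 ck3; move: (sem _ s2) => s3 I0 I1 I3 ck3.
split=> //; first by rewrite -I0 /= orbF.
by rewrite /attempt_time; lia.
Qed.

(** The machine cannot multiply, so each factor [B] is applied by [B] repeated additions. *)
Lemma power_spec k B s : cr s 5 = k -> cr s 6 = B ->
  let s' := sem power_cmd s in
  cr s' 20 = B ^ k /\ clock s' <= clock s + 7 + k * (9 + B * 3).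
Proof.
move=> e5 e6 s'; rewrite /s' /power_cmd !sem_seq.
set c := (X in sem (Loop _ X) _); set s1 := (X in sem (Loop _ _) X).
have e9 : cr s1 9 = k by rewrite /s1 /= /upd /=.
pose I j s' := cr s' 7 = B ^ (k - j).
have [|//|j s2|I0 ck] := @loop_rule I (8 + B * 3) 9 c s1.
- by rewrite e9 /I subnn.
- rewrite e9 => ltj Ij fr.
  have e6' : cr s2 6 = B by rewrite fr.
  rewrite /c !sem_seq.
  set c' := (X in sem (Loop _ X) _); set s3 := (X in sem (Loop _ _) X).
  have e18 : cr s3 18 = B by rewrite /s3 /= /upd /= e6'.
  pose I' i s' := cr s' 19 = (B - i) * B ^ (k - j.+1) /\ cr s' 7 = B ^ (k - j.+1).
  have [|//|i s4|[I19 I7] ck'] := @loop_rule I' 2 18 c' s3.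
  + by rewrite /I' e18 subnn.
  + rewrite e18 => lti [Ia Ib] fr'.
    rewrite /I' /c' /= /upd /= Ia Ib -mulSnr -subSn //; split=> //; lia.
  have ck3 : clock s3 = clock s2 + 4 by rewrite /=; lia.
  move: I19 I7 ck'; rewrite e18 ck3.
  move: (sem (Loop _ _) s3) => s4 I19 I7 ck'.
  rewrite /I /= /upd /= add0n I19 subn0 -expnS -subSn //; split=> //; lia.
have ck1 : clock s1 = clock s + 3 by rewrite /=; lia.
move: I0 ck; rewrite e9 ck1; move: (sem (Loop 9 c) s1) => s2 I0 ck.
by rewrite /= /upd /= add0n I0 subn0; split=> //; lia.
Qed.

(** Counters run down, so the part of a search interval already explored grows at its lower end;
    both nested search loops use this. *)
Lemma ex_interval_step (P : nat -> Prop) j N : j < N ->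
  (exists x, j <= x < N /\ P x) <-> (exists x, j < x < N /\ P x) \/ P j.
Proof.
move=> ltj; split=> [[x [/andP[lej ltx] Px]]|[[x [/andP[lj lx] Px]]|Pj]].
- move: lej; rewrite leq_eqVlt => /orP[/eqP->|lej]; first by right.
  by left; exists x; rewrite lej.
- by exists x; rewrite lx (ltnW lj).
by exists j; rewrite leqnn.
Qed.

Definition try_time n k B : nat :=
  7 + k * (9 + B * 3) + 4 +
  n * (6 + B ^ k * (attempt_time n k (B ^ k)).+2).

Lemma try_spec n k B M s : env n s -> cr s 5 = k -> cr s 6 = B -> 0 < B ->
  cr s 0 = 0 -> (forall a, a < 2 + n * n -> cm s a = M a) ->
  let s' := sem try_cmd s in
  [/\ (0 < cr s' 0) <->
        exists v, 0 <= v < n /\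
        exists x, 0 <= x < B ^ k /\ success n B k (start n M v) x,
      cr s' 0 <= 1, forall a, a < 2 + n * n -> cm s' a = M a
    & clock s' <= clock s + try_time n k B].
Proof.
move=> env_s e5 e6 B0 e0 sM s'; rewrite /s' {s'} /try_cmd sem_seq.
have [e20 ck] := power_spec e5 e6.
have fr x : x \notin writes power_cmd -> cr (sem power_cmd s) x = cr s x.
  exact: sem_frame.
have : cm (sem power_cmd s) = cm s by rewrite sem_storeless.
move: e20 ck fr (env_frame (c := power_cmd) isT env_s).
move: (sem power_cmd s) => s1 e20 ck fr1 env1 m1.
rewrite -!(fr1 0, fr1 5, fr1 6) // -m1 in e5 e6 e0 sM.
rewrite sem_seq; set s2 := sem (copy _ _) s1.
have e8 : cr s2 8 = n by case: env1.
have env2 : env n s2 by [].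
have ck2 : clock s2 = clock s1 + 2 by rewrite /=; lia.
move: s2 e8 env2 ck2 (e5 : cr s2 5 = k) (e6 : cr s2 6 = B) (e0 : cr s2 0 = 0)
  (sM : forall a, a < 2 + n * n -> cm s2 a = M a) (e20 : cr s2 20 = B ^ k).
move=> s2 e8 env2 ck2 e5' e6' e0' sM' e20'.
pose Q v := exists x, 0 <= x < B ^ k /\ success n B k (start n M v) x.
pose I j s' := [/\ (0 < cr s' 0) <-> exists v, j <= v < n /\ Q v,
  cr s' 0 <= 1 & forall a, a < 2 + n * n -> cm s' a = M a].
have [|//|j s3|[I0 I1 I2] ck3] := @loop_rule I
    (5 + B ^ k * (attempt_time n k (B ^ k)).+2) 8 (copy 7 20 ;; Loop 7 attempt_cmd) s2.
- by rewrite e8 /I /= e0'; split=> //; split=> // -[v []]; lia.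
- rewrite e8 => ltj [Ia Ib Ic] fr.
  rewrite sem_seq; set s4 := sem (copy _ _) _.
  have env4 : env n s4.
    by case: env2 => *; split; rewrite /s4 /= /upd /= fr.
  have e7 : cr s4 7 = B ^ k by rewrite /s4 /= /upd /= fr.
  have f8 : cr s4 8 = j by [].
  have f5 : cr s4 5 = k by rewrite /s4 /= /upd /= fr.
  have f6 : cr s4 6 = B by rewrite /s4 /= /upd /= fr.
  have f0 : cr s4 0 = cr s3 0 by [].
  have sM4 : forall a, a < 2 + n * n -> cm s4 a = M a by [].
  have ck4 : clock s4 = clock s3 + 3 by rewrite /=; lia.
  move: s4 env4 e7 f8 f5 f6 f0 sM4 ck4 => s4 env4 e7 f8 f5 f6 f0 sM4 ck4.
  pose I' i s' := [/\ (0 < cr s' 0) <->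
     (0 < cr s3 0) \/ exists x, i <= x < B ^ k /\ success n B k (start n M j) x,
     cr s' 0 <= 1 & forall a, a < 2 + n * n -> cm s' a = M a].
  have [|//|i s5|[I0 I1 I2] ck5] := @loop_rule I'
      (attempt_time n k (B ^ k)).+1 7 attempt_cmd s4.
  + rewrite e7 /I' /= f0; split=> //; split=> [|[//|[x []]]]; [by left | lia].
  + rewrite e7 => lti [Ja Jb Jc] fr'.
    have env5 : env n (setr s5 7 i).
      by case: env4 => *; split; rewrite /= /upd /= fr'.
    have g5 : cr (setr s5 7 i) 5 = k by rewrite /= /upd /= fr'.
    have g6 : cr (setr s5 7 i) 6 = B by rewrite /= /upd /= fr'.
    have g8 : cr (setr s5 7 i) 8 = j by rewrite /= /upd /= fr'.
    have lt8 : cr (setr s5 7 i) 8 < n by rewrite g8.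
    have [] := @attempt_spec n k B M _ env5 g5 g6 B0 Jb lt8 Jc.
    move: (sem attempt_cmd _) => s6.
    rewrite g8 [cr (setr _ _ _) 7]/= [clock (setr _ _ _)]/= [cr (setr _ _ _) 0]/=.
    move=> Ka Kb Kc Kd.
    split; last first.
      (* The code of the run is below [B ^ k], so every run is charged at the value [B ^ k]. *)
      apply: (leq_trans Kd); rewrite addSnnS leq_add2l ltnS /attempt_time.
      by rewrite leq_add2l leq_mul2l leq_add2l leq_mul2r (ltnW lti) !orbT.
    split=> //; rewrite Ka ex_interval_step //; split.
      by case/orP=> [/Ja[]|]; auto.
    by case=> [c|[c|->]]; rewrite ?orbT //; apply/orP; left; apply/Ja; auto.
  split; last by move: ck5; rewrite e7 ck4; lia.
  split=> //; rewrite I0 (ex_interval_step Q ltj) -/(Q j).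
  by split=> -[H|H]; [left; apply/Ia | right | left; apply/Ia | right].
rewrite e8 ck2 in ck3; move: I0 I1 I2 ck3; move: (sem _ s2) => s3 I0 I1 I2 ck3.
by split=> //; rewrite /try_time; lia.
Qed.

Lemma setup_spec n r s : cr s 1 = 1 -> cm s 0 = n -> cm s 1 = r ->
  let s' := sem setup_cmd s in
  [/\ env n s', [/\ cr s' 3 = minn n r, cr s' 5 = 0 & cr s' 0 = 0], cm s' = cm s
    & clock s' <= clock s + 12 + n * 3].
Proof.
move=> e1 e2 e3 s'; rewrite /s' /setup_cmd !sem_seq.
set c := (X in sem (Loop _ X) _); set s1 := (X in sem (Loop _ _) X).
have e15 : cr s1 15 = n by [].
pose I j s' := cr s' 4 = 2 + (n - j) * n.
have [|//|j s2|I4 ck] := @loop_rule I 2 15 c s1.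
- by rewrite e15 /I subnn.
- rewrite e15 => ltj Ij fr; rewrite /I /c /= /upd /= (fr 2) //.
  by rewrite (_ : cr s1 2 = n) // Ij -addnA -mulSnr -subSn //; split=> //; lia.
have fr x : x \notin writes (Loop 15 c) -> cr (sem (Loop 15 c) s1) x = cr s1 x.
  exact: sem_frame.
have : cm (sem (Loop 15 c) s1) = cm s by rewrite sem_storeless.
have ck1 : clock s1 = clock s + 6 by rewrite /=; lia.
have f1 : cr s1 1 = 1 by [].
have f2 : cr s1 2 = n by [].
have f3 : cr s1 3 = r by rewrite /s1 /= /upd /= e1.
move: I4 ck fr; rewrite e15 ck1; move: (sem _ s1) => s2 I4 ck fr m2.
rewrite /= /upd /=; split=> //; last by lia.
- by split; rewrite /= /upd /= ?I4 ?subn0 // fr.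
by split=> //; rewrite fr // fr // f2 f3; lia.
Qed.

(** Monotonicity lets every executed round be charged at the price of the largest [k] tried. *)
Lemma leq_try_time n k1 k2 : 0 < k1 <= k2 ->
  try_time n k1 (k1 + k1) <= try_time n k2 (k2 + k2).
Proof.
case/andP=> k1_gt0 le12; rewrite /try_time.
have leN : (k1 + k1) ^ k1 <= (k2 + k2) ^ k2.
  by apply: (@leq_trans ((k2 + k2) ^ k1)); [rewrite leq_exp2r | rewrite leq_pexp2l]; lia.
move: ((k1 + k1) ^ k1) ((k2 + k2) ^ k2) leN => N1 N2 leN.
have leatt : attempt_time n k1 N1 <= attempt_time n k2 N2.
  by rewrite leq_add2l leq_mul // leq_add2l leq_mul2r leN.
by rewrite !leq_add // leq_mul // leq_add2l ?leq_mul //; lia.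
Qed.

(** [Q k] stands for the existence of an alliance of size at most [k], and [K0] lies above every
    [k < minn n r] at which [Q] fails. The invariant is that the flag decides [Q] at the number of
    completed rounds. *)
Lemma main_spec n r K0 (Q : nat -> Prop) M s :
  cr s 1 = 1 -> cm s = M -> M 0 = n -> M 1 = r -> ~ Q 0 ->
  (forall k, Q k -> Q k.+1) ->
  (forall k, 0 < k -> Q k <-> exists v, 0 <= v < n /\
     exists x, 0 <= x < (k + k) ^ k /\ success n (k + k) k (start n M v) x) ->
  (forall k, k < minn n r -> ~ Q k -> k < K0) ->
  let s' := sem main_cmd s in
  [/\ cr s' 0 <= 1, (0 < cr s' 0) <-> Q (minn n r)
    & clock s' <= clock s + 14 + n * 3 + n * (try_time n K0 (K0 + K0) + 6)].
Proof.
move=> e1 eM M0 M1 Q0 QS QE QK s'; rewrite /s' /main_cmd sem_seq.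
move: (M0) (M1); rewrite -eM => m0 m1.
have [] := setup_spec e1 m0 m1; rewrite eM.
move: (sem setup_cmd s) => s1 env1 [e3 e5 e0] {}eM ck1.
set c := (X in sem (Loop _ X) _); set K := minn n r in e3 QK *.
pose I j s' := [/\ (0 < cr s' 0) <-> Q (K - j), cr s' 0 <= 1, cr s' 5 = K - j &
  forall a, a < 2 + n * n -> cm s' a = M a].
have [|//|j s2|[I0 I1 _ _] ck] := @loop_rule I (try_time n K0 (K0 + K0) + 5) 3 c s1.
- by rewrite e3 /I /= e0 subnn eM.
- rewrite e3 => ltj [Ia Ib Ic Id] fr; rewrite /c !sem_seq sem_if.
  set s3 := sem (Ins _) _.
  have env3 : env n s3 by case: env1 => *; split; rewrite /s3 /= /upd /= fr.
  have k_gt0 : 0 < K - j by lia.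
  have g1 : cr s2 1 = 1 by rewrite fr //; case: env1.
  have f5 : cr s3 5 = K - j by rewrite /s3 /= /upd /= Ic g1; lia.
  have f6 : cr s3 6 = (K - j) + (K - j).
    by rewrite -f5.
  have f0 : cr s3 0 = cr s2 0 by [].
  have f4 : forall a, a < 2 + n * n -> cm s3 a = M a by [].
  have ck3 : clock s3 = clock s2 + 3 by rewrite /=; lia.
  move: s3 env3 f5 f6 f0 f4 ck3 => s3 env3 f5 f6 f0 f4 ck3.
  have eK : (K - j.+1).+1 = K - j by rewrite subnSK.
  case: ifP => pos.
    rewrite /I /= pos; split; last by lia.
    split=> //; last by rewrite f0.
    by split=> // _; rewrite -eK; apply: QS; apply/Ia; rewrite -f0.
  have z0 : cr s3 0 = 0 by lia.
  have B_gt0 : 0 < (K - j) + (K - j) by lia.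
  have fr4 x : x \notin writes try_cmd -> cr (sem try_cmd (tick s3)) x = cr s3 x.
    exact: sem_frame.
  have [] := @try_spec n (K - j) _ M (tick s3) env3 f5 f6 B_gt0 z0 f4.
  move: fr4; move: (sem try_cmd _) => s4 fr4 h0 h1 h2 h3.
  (* The search is run only if the previous size failed, and that size is then below [K0]. *)
  have leK : K - j <= K0.
    rewrite -eK; apply: QK; first by lia.
    by move/Ia; rewrite -f0 pos.
  split; last first.
    have := @leq_try_time n (K - j) K0; rewrite k_gt0 leK => /(_ isT).
    by move: h3; rewrite /=; lia.
  split=> //=; first by rewrite h0 QE.
  by rewrite fr4.
rewrite e3 in ck; move: I0 I1 ck; rewrite subn0.
move: (sem _ s1) => s2 I0 I1 ck; split=> //.
have : K * (try_time n K0 (K0 + K0) + 5).+1 <= n * (try_time n K0 (K0 + K0) + 6).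
  by rewrite -addnS leq_mul // geq_minl.
by lia.
Qed.

(** * Correctness of the search *)

Section Degrees.
Variables (T : finType) (e : rel T).
Hypothesis e_sym : symmetric e.

Lemma deg_in_gt0 (S : {set T}) v : (0 < deg_in e S v) = [exists u in S, e u v].
Proof.
apply/card_gt0P/existsP => -[u]; first by rewrite inE e_sym => ?; exists u.
by exists u; rewrite inE e_sym.
Qed.

Lemma deg_in_split (S : {set T}) v :
  deg_in e S v + deg_in e (~: S) v = #|[set u | e v u]|.
Proof.
rewrite -(cardsID S); congr (_ + _); apply: eq_card => u; rewrite !inE andbC //.
Qed.

Lemma deg_in_card (S : {set T}) v : deg_in e S v <= #|S|.
Proof.
by apply: subset_leq_card; apply/subsetP => u; rewrite inE => /andP[].
Qed.

(** Since [v] lies in N(A), strictly more than half of its neighbours are in [A], so its degree is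
    below [2 * #|A|]. As [S] does not contain a majority of them, [A] has a neighbour of [v] beyond
    [S]. *)
Lemma unsatisfied_neighbour (S A : {set T}) v : S \subset A ->
  offensive_alliance e A -> v \notin A -> v \in open_nbhd e S ->
  deg_in e S v <= deg_in e (~: S) v ->
  #|[set u | e v u]| < #|A| + #|A| /\ exists2 u, u \in A :\: S & e v u.
Proof.
move=> sSA [_ aA] vnA vS le_deg.
have vNA : v \in open_nbhd e A.
  move: vS; rewrite !inE vnA => /andP[_ /existsP[u /andP[uS uv]]].
  by apply/existsP; exists u; rewrite (subsetP sSA).
have degA := aA v vNA; have eS := deg_in_split S v; have eA := deg_in_split A v.
have leA := deg_in_card A v; split; first by lia.
have /subsetPn[u] : ~~ ([set u in A | e v u] \subset [set u in S | e v u]).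
  apply/negP => sub.
  have leAS : deg_in e A v <= deg_in e S v by exact: subset_leq_card sub.
  by lia.
rewrite !inE => /andP[uA vu]; rewrite vu andbT => uS.
by exists u; rewrite ?inE ?uS.
Qed.

(** A vertex outside a cover has all its neighbours inside it. *)
Lemma vertex_cover_alliance (C : {set T}) :
  vertex_cover e C -> C != set0 -> offensive_alliance e C.
Proof.
move=> covC C0; split=> // v; rewrite inE -deg_in_gt0 => /andP[vC degC].
suff -> : deg_in e (~: C) v = 0 by rewrite add0n.
apply/eqP; rewrite cards_eq0; apply/eqP/setP => u; rewrite !inE.
have /forallP/(_ v)/forallP/(_ u) := covC.
by rewrite (negbTE vC); case: (e v u); case: (u \in C).
Qed.

End Degrees.

(** * Soundness and completeness of the search on a graph stored in memory *)

Section Search.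
Variables (n : nat) (e : rel 'I_n).
Hypothesis e_sym : symmetric e.

Definition represents (m : nat -> nat) (S : {set 'I_n}) : Prop :=
  (forall v u : 'I_n, m (2 + v * n + u) = e v u) /\
  S = [set u : 'I_n | sel n m u].

Lemma adjE m S (v u : 'I_n) : represents m S -> adj n m v u = e v u.
Proof. by case=> mE _; rewrite /adj mE; case: (e v u). Qed.

Lemma selE m S (u : 'I_n) : represents m S -> sel n m u = (u \in S).
Proof. by case=> _ ->; rewrite inE. Qed.

Lemma indegE m S (v : 'I_n) : represents m S -> indeg n m v = deg_in e S v.
Proof.
move=> mS; rewrite /indeg big_mkord /deg_in -sum1_card big_mkcond [RHS]big_mkcond.
apply: eq_bigr => u _; rewrite inE (adjE _ _ mS) (selE _ mS) andbC.
by case: (_ && _).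
Qed.

Lemma outdegE m S (v : 'I_n) : represents m S -> outdeg n m v = deg_in e (~: S) v.
Proof.
move=> mS; rewrite /outdeg big_mkord /deg_in -sum1_card big_mkcond [RHS]big_mkcond.
apply: eq_bigr => u _; rewrite !inE (adjE _ _ mS) (selE _ mS) andbC.
by case: (_ && _).
Qed.

Lemma badE m S (v : 'I_n) : represents m S ->
  bad n m v = (v \in open_nbhd e S) && (deg_in e S v <= deg_in e (~: S) v).
Proof.
move=> mS; rewrite /bad (selE _ mS) (indegE _ mS) (outdegE _ mS) inE (deg_in_gt0 e_sym).
by rewrite andbA.
Qed.

Lemma violator_eq0 m S : represents m S -> S != set0 -> violator n m = 0 ->
  offensive_alliance e S.
Proof.
move=> mS S0 c0; split=> // v vS.
case: (violator_cases n m) => [[w]|[_ /(_ v (ltn_ord v))]]; first by rewrite c0.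
by rewrite (badE _ mS) vS -ltnNge addn1.
Qed.

Lemma chosen_lt m v d : v < n -> chosen n m v d < n.
Proof.
move=> ltv; apply: (@down_ind _ (fun _ p => p.2 < n)) => // j p ltj ltp.
by rewrite /scan_neighbour; case: ifP => //= _; case: ifP.
Qed.

Lemma represents_upd m S (w : 'I_n) :
  represents m S -> represents (upd m (2 + n * n + w) 1) (w |: S).
Proof.
move=> [mE ->]; split=> [v u|].
  rewrite updE mE; case: eqP => // E; have := ltn_ord v; have := ltn_ord u.
  by move: E; nia.
apply/setP => u; rewrite !inE /sel updE eqn_add2l.
by rewrite -[nat_of_ord u == w]/(u == w); case: eqP.
Qed.

Lemma chosen0 m v : chosen n m v 0 = v.
Proof.
suff [] : (fun p => p.1 = 0 /\ p.2 = v) (down n (scan_neighbour n m v) (0, v)) by [].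
apply: (@down_ind _ (fun _ p => p.1 = 0 /\ p.2 = v)) => // j p _ [p1 p2].
by rewrite /scan_neighbour p1 andbF.
Qed.

(* Neighbours are scanned downwards, so u is found at its rank from the top. *)
Lemma chosen_rank m v u : u < n -> adj n m v u ->
  chosen n m v (\sum_(u <= w < n) adj n m v w) = u.
Proof.
(* Until [u] is passed, the counter is the number of neighbours in [[u, j)]; it is thus 1 on
   reaching [u], after which the pair is frozen at [(0, u)]. *)
move=> ltu vu; pose I j (p : nat * nat) :=
  if u < j then p.1 = \sum_(u <= w < j) adj n m v w else p = (0, u).
suff : I 0 (down n (scan_neighbour n m v) (\sum_(u <= w < n) adj n m v w, v)).
  by rewrite /I ltn0 /chosen => ->.
apply: down_ind; first by rewrite /I ltu.
move=> j [a b] ltj; rewrite /I ltnS /scan_neighbour /=.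
case: (ltngtP u j) => [ltuj|ltju|<-] /=.
- rewrite big_nat_recr /=; last exact: ltnW.
  by move=> ->; case: (adj n m v j) => /=; rewrite ?addn1 ?addn0.
- by move=> [-> ->]; rewrite andbF.
by rewrite big_nat1 vu => -> /=.
Qed.

(** Each step adds at most one vertex, and the last of the [k] steps only confirms that the set is
    an alliance; hence the strict bound. *)
Lemma success_sound B k m S q : represents m S -> S != set0 -> success n B k m q ->
  exists T : {set 'I_n}, offensive_alliance e T /\ #|T| < #|S| + k.
Proof.
elim: k m S q => [|k IH] m S q //= mS S0.
case: (violator_cases n m) => [[v -> /andP[ltv _]]|[c0 _ _]]; last first.
  by exists S; split; [exact: violator_eq0 mS S0 c0 | lia].
pose w := Ordinal (chosen_lt m (q %% B) ltv).
move/(IH _ _ _ (represents_upd w mS)); case.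
  by apply/set0Pn; exists w; rewrite !inE eqxx.
move=> T [aT ltT]; exists T; split=> //; apply: leq_trans ltT _.
by rewrite cardsU1 addnS -addSn leq_add2r -add1n leq_add2r leq_b1.
Qed.

(* If the violated vertex v is not in T, then v has at most 2|T| - 1 neighbours,
   one of which lies in T but not in S. *)
Lemma branching_step k m (S T : {set 'I_n}) (v : 'I_n) :
  represents m S -> S \subset T ->
  offensive_alliance e T -> #|T| <= k -> bad n m v ->
  exists2 d, d < k + k & exists2 w : 'I_n, w \in T :\: S & chosen n m v d = w.
Proof.
move=> mS sST aT leT; rewrite (badE _ mS) => /andP[vS le_deg].
have vnS : v \notin S by move: vS; rewrite inE => /andP[].
have [vT|vnT] := boolP (v \in T).
  have T_gt0 : 0 < #|T| by rewrite card_gt0; apply/set0Pn; exists v.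
  (* Digit 0 makes the scan return [v] itself. *)
  by exists 0; [lia | exists v; rewrite ?chosen0 // inE vnS].
have [lt_deg [u uT vu]] := unsatisfied_neighbour sST aT vnT vS le_deg.
(* The digit is the rank of [u] among the neighbours of [v] counted from the top, hence at most the
   degree of [v]. *)
exists (\sum_(u <= w < n) adj n m v w); last first.
  by exists u => //; rewrite chosen_rank // (adjE _ _ mS).
have : \sum_(u <= w < n) adj n m v w <= #|[set u | e v u]|.
  rewrite -(deg_in_split _ S) -(indegE _ mS) -(outdegE _ mS) /indeg /outdeg -big_split /=.
  rewrite [leqRHS](big_cat_nat (n := u)) //=; last exact: ltnW.
  rewrite [X in _ <= _ + X](eq_bigr (fun w => adj n m v w : nat)) => [|w _].
    exact: leq_addl.
  by case: (adj _ _ _ _); case: (sel _ _ _).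
by move=> le_sum; apply: leq_ltn_trans le_sum (leq_trans lt_deg _); rewrite leq_add.
Qed.

(** Digits are chosen so that every new vertex lies in [T] outside [S]. The set stays inside [T] and
    grows strictly, so it becomes an alliance before the steps run out. *)
Lemma success_complete k j m (S T : {set 'I_n}) : represents m S -> S \subset T ->
  offensive_alliance e T -> #|T| <= k -> S != set0 -> #|T| < #|S| + j ->
  exists q, 0 <= q < (k + k) ^ j /\ success n (k + k) j m q.
Proof.
elim: j m S => [|j IH] m S mS sST aT leT S0 ltT.
  by move: (subset_leq_card sST) ltT; lia.
have k_gt0 : 0 < k.
  by move: (subset_leq_card sST) S0; rewrite -card_gt0; lia.
rewrite /=; case: (violator_cases n m) => [[v -> /andP[ltv badv]]|[-> _]]; last first.
  by exists 0; rewrite expn_gt0; split=> //; lia.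
have [d ltd [w wTS cw]] := branching_step (v := Ordinal ltv) mS sST aT leT badv.
move: wTS; rewrite inE => /andP[wnS wT].
have [|||q [/andP[_ ltq] sq]] := IH _ _ (represents_upd w mS) _ aT leT.
- by rewrite subUset sub1set wT.
- by apply/set0Pn; exists w; rewrite !inE eqxx.
- by rewrite cardsU1 wnS add1n addSnnS.
(* The first choice is the lowest digit, because a run decodes by remainder and quotient. *)
exists (q * (k + k) + d); rewrite divnMDl ?modnMDl; last by lia.
rewrite modn_small // divn_small // addn0 cw; split=> //.
by rewrite expnSr; nia.
Qed.

(** A minimum vertex cover serves if it is non-empty. Otherwise the graph has no edges, and any
    single vertex is an alliance with empty neighbourhood. *)
Lemma small_alliance : 0 < n ->
  exists T : {set 'I_n}, offensive_alliance e T /\ #|T| <= maxn 1 (vc e).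
Proof.
move=> n_gt0; rewrite /vc; case: arg_minnP => [|C covC _].
  by apply/forallP => u; apply/forallP => v; rewrite !inE implybT.
have [C0|Cn0] := eqVneq C set0; last first.
  by exists C; split; [exact: vertex_cover_alliance | rewrite leq_maxr].
exists [set Ordinal n_gt0]; split; last by rewrite cards1 leq_maxl.
split; first by apply/set0Pn; exists (Ordinal n_gt0); rewrite inE.
move=> v; rewrite inE => /andP[_ /existsP[u /andP[_ uv]]].
have /forallP/(_ u)/forallP/(_ v) := covC.
by rewrite uv C0 !inE.
Qed.

End Search.

(** * The input encoding and the search started from it *)

Lemma nth_allpairs (A B C : Type) (f : A -> B -> C) (s : seq A) (t : seq B)
    a b c i j : i < size s -> j < size t ->
  nth c [seq f x y | x <- s, y <- t] (i * size t + j) = f (nth a s i) (nth b t j).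
Proof.
elim: s i => [|x s IH] [|i] //= lti ltj; rewrite nth_cat size_map.
  by rewrite mul0n add0n ltj (nth_map b).
by rewrite mulSn -addnA ltnNge leq_addr /= addKn IH.
Qed.

Lemma nth_encode n (e : rel 'I_n) r (v u : 'I_n) :
  nth 0 (encode e r) (2 + v * n + u) = e v u.
Proof.
rewrite -addnA /= -[n in _ * n](size_enum_ord n).
by rewrite (nth_allpairs _ v u) ?size_enum_ord // !nth_ord_enum.
Qed.

Lemma represents_start n (e : rel 'I_n) r (v : 'I_n) :
  represents e (start n (nth 0 (encode e r)) v) [set v].
Proof.
split=> [w u|]; rewrite /start.
  rewrite nth_encode ifT //; have := ltn_ord w; have := ltn_ord u; nia.
apply/setP => u; rewrite !inE /sel ifF ?eqn_add2l; last by lia.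
by rewrite -[nat_of_ord u == v]/(u == v); case: eqP.
Qed.

(** A successful run can start at any vertex of the alliance. Conversely, a run from a singleton
    yields size below [1 + k]. *)
Lemma search_correct n (e : rel 'I_n) r k : symmetric e -> 0 < k ->
  (exists T : {set 'I_n}, offensive_alliance e T /\ #|T| <= k) <->
  exists v, 0 <= v < n /\ exists x, 0 <= x < (k + k) ^ k /\
    success n (k + k) k (start n (nth 0 (encode e r)) v) x.
Proof.
move=> e_sym k_gt0; split=> [[T [aT leT]]|[v [/= ltv [x [_ sx]]]]].
  have [/set0Pn[v vT] _] := aT; exists v; split=> //=.
  apply: (success_complete e_sym (represents_start e r v) _ aT leT).
  - by rewrite sub1set.
  - by apply/set0Pn; exists v; rewrite inE.
  by rewrite cards1.
have [|T [aT ltT]] := success_sound e_sym (represents_start e r (Ordinal ltv)) _ sx.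
  by apply/set0Pn; exists (Ordinal ltv); rewrite inE.
by exists T; split=> //; move: ltT; rewrite cards1.
Qed.

(** * Input size and running time estimates *)

Lemma leq_size_input_size (s : seq nat) : size s <= input_size s.
Proof.
rewrite /input_size; elim: s => [|x s IH]; first by rewrite big_nil.
by rewrite big_cons /= -add1n leq_add.
Qed.

Lemma size_encode n (e : rel 'I_n) r : size (encode e r) = n * n + 2.
Proof. by rewrite /= size_allpairs size_enum_ord addn2. Qed.

Lemma vc_leq n (e : rel 'I_n) : vc e <= n.
Proof. by rewrite -[n in leqRHS]card_ord; apply: max_card. Qed.

(** For [w >= 2] one has [2 * w <= w * w]. The factor 2 covers [w = 0] and [w = 1], where the left
    side is 2 and [0 ^ 0 = 1]. *)
Lemma branching_bound w :
  let k := maxn 1 w in (k + k) ^ k <= 2 * w ^ (2 * w).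
Proof.
case: w => [|[|w]] //=; set x := w.+2.
rewrite (maxn_idPr _) // expnM -mulnn.
apply: (@leq_trans ((x * x) ^ x)); last by rewrite leq_pmull.
by rewrite leq_exp2r // addnn -mul2n leq_mul.
Qed.

(** One factor [N] counts the codes of runs and the other pays for division by counting. The power
    [L ^ 5] collects the rounds, the first vertices, the steps of a run and the quadratic check. *)
Lemma time_bound n k N L : 0 < k <= n -> n < L -> 0 < N -> N = (k + k) ^ k ->
  16 + n * 3 + n * (try_time n k (k + k) + 6) <= 200 * N ^ 2 * L ^ 5.
Proof.
case/andP=> k_gt0 lekn ltnL N_gt0 EN; rewrite /try_time -EN.
have L_gt0 : 0 < L by lia.
have mono i j : i <= j -> L ^ i <= L ^ j by move=> lij; rewrite leq_pexp2l.
have att : (attempt_time n k N).+2 <= 111 * N * L ^ 3.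
  rewrite /attempt_time.
  have : 31 + n * (n * 14 + 39) + N * 8 <= 92 * N * L ^ 2.
    have nn : n * (n * 14 + 39) <= 53 * (L * L) by nia.
    have LL : L * L <= N * (L * L) by rewrite leq_pmull.
    have NN : N <= N * (L * L) by rewrite leq_pmulr // muln_gt0 L_gt0.
    rewrite -mulnA -mulnn; move: (N * (L * L)) nn LL NN => Y.
    by move: (n * _) (L * L) => Y1 Y2; lia.
  move: (31 + _ + _) => X leX.
  have : k * X <= L * (92 * N * L ^ 2) by rewrite leq_mul // ltnW // (leq_ltn_trans lekn).
  have -> : L * (92 * N * L ^ 2) = 92 * N * L ^ 3 by rewrite (expnS L 2); lia.
  have : L <= N * L ^ 3.
    by rewrite -[leqLHS]mul1n leq_mul // -[leqLHS]expn1 mono.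
  by nia.
have inner : n * (6 + N * (attempt_time n k N).+2) <= 117 * N ^ 2 * L ^ 4.
  apply: (@leq_trans (L * (6 + N * (111 * N * L ^ 3)))).
    by rewrite leq_mul ?(ltnW ltnL) // leq_add2l leq_mul.
  rewrite (expnS L 3) -mulnn.
  have : 0 < N * N * L ^ 3 by rewrite !muln_gt0 N_gt0 L_gt0.
  by move: (L ^ 3) => Y; nia.
have pow : k * (9 + (k + k) * 3) <= 15 * N ^ 2 * L ^ 4.
  apply: (@leq_trans (15 * L ^ 2)); first by rewrite -mulnn; nia.
  rewrite -mulnA leq_mul2l /=.
  by rewrite -[leqLHS]mul1n leq_mul ?mono // expn_gt0 N_gt0.
have one : 0 < N ^ 2 * L ^ 4 by rewrite muln_gt0 !expn_gt0 N_gt0 L_gt0.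
rewrite (expnS L 4).
move: (attempt_time _ _ _) (N ^ 2) (L ^ 4) inner pow one => A N2 L4.
move: (n * (6 + _)) (k * _) => X1 X2 inner pow one.
have : 7 + X2 + 4 + X1 + 6 <= 149 * (N2 * L4) by lia.
move: (7 + X2 + 4 + X1 + 6) => Z leZ.
have : n * Z <= L * (149 * (N2 * L4)) by rewrite leq_mul // ltnW.
have : L <= L * (N2 * L4) by rewrite leq_pmulr.
by nia.
Qed.

Theorem theorem6 :
  exists (P : program) (a b c : nat),
    forall (n : nat) (e : rel 'I_n) (r : nat),
      symmetric e -> irreflexive e -> 1 <= r ->
      decides_within P (encode e r)
        (exists S : {set 'I_n}, offensive_alliance e S /\ 1 <= #|S| <= r)
        (a * vc e ^ (b * vc e) * input_size (encode e r) ^ c).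
Proof.
(* The first instruction sets the constant register, and [s0] is the state after it. With
   [N <= 2 * vc ^ (2 * vc)], the bound [200 * N ^ 2 * L ^ 5] gives the constants [800 = 200 * 4], 4
   and 5. *)
exists (IConst 1 1 :: compile main_cmd 1), 800, 4, 5 => n e r e_sym _ r_gt0.
pose M := nth 0 (encode e r); pose s0 := CState (upd (fun=> 0) 1 1) M 1.
pose Q k := exists T : {set 'I_n}, offensive_alliance e T /\ #|T| <= k.
pose K0 := maxn 1 (vc e).
have Q0 : ~ Q 0 by case=> T [[T0 _]]; rewrite leqNgt card_gt0 T0.
have QS k : Q k -> Q k.+1 by case=> T [aT leT]; exists T; split=> //; apply: ltnW.
have QE k (k_gt0 : 0 < k) := search_correct r e_sym k_gt0.
(* An alliance of size at most [K0] exists as soon as there is a vertex, so only sizes below [K0]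
   can fail. *)
have QK k : k < minn n r -> ~ Q k -> k < K0.
  rewrite ltnNge => ltk nQ; rewrite ltnNge; apply/negP => leK; apply: nQ.
  have n_gt0 : 0 < n by lia.
  have [T [aT leT]] := small_alliance e_sym n_gt0.
  by exists T; split=> //; apply: leq_trans leT leK.
have [le1 foundE ck] :=
  main_spec (n := n) (r := r) (s := s0) (M := M) erefl erefl erefl erefl Q0 QS QE QK.
have := @compile_correct main_cmd [:: IConst 1 1] [::] s0 isT isT erefl.
rewrite cats0 => -[t [ct et]].
have run : iter t.+1 (step (IConst 1 1 :: compile main_cmd 1)) (init (encode e r))
    = at_pc (1 + csize main_cmd) (sem main_cmd s0).
  by rewrite iterSr.
exists t.+1; rewrite run; move: le1 foundE ck ct; move: (sem main_cmd s0) => s1.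
move=> le1 foundE ck ct; split.
- have : t.+1 <= 16 + n * 3 + n * (try_time n K0 (K0 + K0) + 6).
    by move: ck; rewrite ct /=; lia.
  move=> le_t; apply: leq_trans le_t _.
  have : n * n + 2 <= input_size (encode e r).
    by rewrite -(size_encode e r) leq_size_input_size.
  move: (input_size _) => L leL.
  have [n0|n_gt0] := posnP n.
    (* Without vertices the exponential factor is [0 ^ 0 = 1], and the two header cells give
       [L >= 2]. *)
    have -> : vc e = 0 by have := vc_leq e; lia.
    rewrite n0 muln0 expn0 muln1; have : 2 ^ 5 <= L ^ 5 by rewrite leq_exp2r //; lia.
    by move: (L ^ 5) => Y; lia.
  have lek : 0 < K0 <= n by rewrite leq_maxl geq_max n_gt0 vc_leq.
  have N_gt0 : 0 < (K0 + K0) ^ K0 by rewrite expn_gt0; lia.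
  have ltnL : n < L by nia.
  apply: leq_trans (time_bound lek ltnL N_gt0 erefl) _.
  rewrite leq_mul2r; apply/orP; right.
  have le2 : ((K0 + K0) ^ K0) ^ 2 <= 4 * vc e ^ (4 * vc e).
    have -> : 4 * vc e = 2 * vc e * 2 by lia.
    rewrite expnM -[4]/(2 ^ 2) -expnMn leq_exp2r //; exact: branching_bound.
  apply: leq_trans (leq_mul (leqnn 200) le2) _.
  by move: (vc e ^ _) => Y; lia.
- by [].
exists (0 < cr s1 0); split; first by rewrite /=; lia.
rewrite foundE; split=> -[T [aT leT]]; exists T; split=> //.
  case: aT => T0 _; rewrite card_gt0 T0; apply: leq_trans leT _; exact: geq_minr.
(* A vertex set has at most [n] elements, so the cap at [n] excludes no alliance. *)
rewrite leq_min; case/andP: leT => _ ->; rewrite andbT.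
by rewrite -[n in leqRHS]card_ord; apply: max_card.
Qed.
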